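(* Let $\{x_k\}_{k\ge 0}$ be generated by the time-varying gradient descent (TVGD) recursion $x_{k+1}=x_k-\beta\nabla_x f(x_k;t_k)$ from an arbitrary $x_0\in\mathbb{R}^d$, with step size $\beta=1/L_1$. Suppose that (1) $f(\cdot;t)$ is twice differentiable with $\|\nabla_{xx}f(x;t)\|\le L_1$ for all $x\in\mathbb{R}^d$, $t\ge 0$; (2) there exists a function $\mathscr{G}:\mathbb{R}\to\mathbb{R}$ such that $|[f(x;s)-\mathscr{G}(s)]-[f(x;t)-\mathscr{G}(t)]|\le G_2|s-t|$ for all $x\in\mathbb{R}^d$ and all $s,t\ge 0$. Put $\epsilon:=2\sqrt{L_1(1+G_2)h}$, and suppose that for some $\bar T\in\mathbb{Z}_{\ge0}$ the iterate $x_{\bar T}$ is an $\epsilon$-stationary point of $f(\cdot;t_{\bar T})$. Then for every $k\ge\bar T$ at least one of the following holds: (a) $x_k$ is an $\epsilon$-stationary point of $f(\cdot;t_k)$; (b) there exists an integer $0\le l<k$ such that $x_l$ is an $\epsilon$-stationary point of $f(\cdot;t_l)$ and $$(f_k-f_k^\ast)<(f_l-f_l^\ast)+2G_2h-\frac{1}{2L_1}\|\nabla_x f(x_l;t_l)\|^2.$$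
   Context: $f:\mathbb{R}^d\times\mathbb{R}\to\mathbb{R}$, $(x,t)\mapsto f(x;t)$, is a time-varying objective function; $h>0$ is the sampling period and $t_k:=kh$. For each $t\ge0$ the problem $\min_{x\in\mathbb{R}^d}f(x;t)$ is assumed to have an optimal solution $x^\ast(t)$; $f_k^\ast:=\min_{x}f(x;t_k)$ is the optimal value at time $t_k$, and $f_k:=f(x_k;t_k)$. A point $x$ is an $\epsilon$-stationary point of $f(\cdot;t)$ if $\|\nabla_x f(x;t)\|\le\epsilon$. $\nabla_x$ denotes the gradient and $\nabla_{xx}$ the Hessian in $x$; $\|\cdot\|$ is the Euclidean norm for vectors and the operator norm for matrices. $L_1>0$ and $G_2\ge 0$ are constants. (The general TVGD algorithm performs $C$ gradient steps per time step; the number of steps here is $C=1$.) *)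

(* Defs.v *)
From HB Require Import structures.
From mathcomp Require Import all_boot all_order all_algebra.
From mathcomp Require Import all_classical all_reals all_analysis.

Set Implicit Arguments.
Unset Strict Implicit.
Unset Printing Implicit Defensive.

Import Order.TTheory GRing.Theory Num.Theory.
Import numFieldNormedType.Exports.

Local Open Scope classical_set_scope.
Local Open Scope ring_scope.

(* The canonical norm `|v| on 'rV[R]_d is the sup norm, hence an explicit
   Euclidean norm; both induce the topology used by [differentiable]. *)
Definition enorm (R : realType) (d : nat) (v : 'rV[R]_d) : R :=
  Num.sqrt (\sum_(i < d) v 0 i ^+ 2).

(* Operator norm for [enorm], a matrix acting on row vectors by right
   multiplication, which is also the convention of the jacobian 'J. *)
Definition opnorm (R : realType) (d : nat) (A : 'M[R]_d) : R :=
  sup [set enorm (v *m A) | v in [set v : 'rV[R]_d | enorm v <= 1]].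

Definition gradient (R : realType) (d : nat) (g : 'rV[R]_d -> R)
    (x : 'rV[R]_d) : 'rV[R]_d :=
  \row_(i < d) 'D_(delta_mx 0 i) g x.

Definition hessian (R : realType) (d : nat) (g : 'rV[R]_d -> R)
    (x : 'rV[R]_d) : 'M[R]_d :=
  'J (gradient g) x.

Definition twice_differentiable (R : realType) (d : nat)
    (g : 'rV[R]_d -> R) : Prop :=
  (forall x, differentiable g x) /\ (forall x, differentiable (gradient g) x).

Definition is_minimizer (R : realType) (d : nat) (g : 'rV[R]_d -> R)
    (x : 'rV[R]_d) : Prop :=
  forall y, g x <= g y.

Definition eps_stationary (R : realType) (d : nat) (eps : R)
    (g : 'rV[R]_d -> R) (x : 'rV[R]_d) : Prop :=
  enorm (gradient g x) <= eps.

Definition sample_time (R : realType) (h : R) (k : nat) : R := k%:R * h.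

Definition tvgd (R : realType) (d : nat) (f : 'rV[R]_d -> R -> R) (h beta : R)
    (x : nat -> 'rV[R]_d) : Prop :=
  forall k, x k.+1 = x k - beta *: gradient (f ^~ (sample_time h k)) (x k).

(* f(x_k; t_k) - min_x f(x; t_k), where [xstar t] is a minimizer of f(.; t). *)
Definition opt_gap (R : realType) (d : nat) (f : 'rV[R]_d -> R -> R)
    (xstar : R -> 'rV[R]_d) (h : R) (x : nat -> 'rV[R]_d) (k : nat) : R :=
  f (x k) (sample_time h k) - f (xstar (sample_time h k)) (sample_time h k).

(* Main.v *)
(** By the descent lemma and the bound on the drift of f in time,
    f(y; t_{k+1}) <= M_k + L1/2 |y - x_{k+1}|^2 for all y, and y = x_{k+1} gives
    gap_{k+1} <= gap_k + 2 G2 h - |grad_k|^2 / (2 L1). At a non-stationary iterate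
    the right-hand side is smaller than gap_k, so the gap decreases along a run of
    non-stationary iterates, and l is the last stationary index before k.
    The inequality is strict even when k = l + 1: equality would mean that
    f(.; t_k) touches the paraboloid at its vertex x_k, so that its gradient
    vanishes there, whereas x_k is not stationary. *)

Require Import Defs.
From HB Require Import structures.
From mathcomp Require Import all_boot all_order all_algebra.
From mathcomp Require Import all_classical all_reals all_analysis.
From mathcomp Require Import ring lra.

Set Implicit Arguments.
Unset Strict Implicit.
Unset Printing Implicit Defensive.

Import Order.TTheory GRing.Theory Num.Theory.
Import numFieldNormedType.Exports.

Local Open Scope ring_scope.

(** * Euclidean inner product and norm *)

Definition dotv (R : realType) (d : nat) (u v : 'rV[R]_d) : R :=
  \sum_(i < d) u 0 i * v 0 i.

Lemma dotvDr (R : realType) (d : nat) (u v w : 'rV[R]_d) :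
  dotv u (v + w) = dotv u v + dotv u w.
Proof. by rewrite -big_split; apply: eq_bigr => i _; rewrite mxE mulrDr. Qed.

Lemma dotvZr (R : realType) (d : nat) (a : R) (u v : 'rV[R]_d) :
  dotv u (a *: v) = a * dotv u v.
Proof. by rewrite mulr_sumr; apply: eq_bigr => i _; rewrite mxE mulrCA. Qed.

Lemma dotvC (R : realType) (d : nat) (u v : 'rV[R]_d) : dotv u v = dotv v u.
Proof. by apply: eq_bigr => i _; rewrite mulrC. Qed.

Lemma dotv_delta (R : realType) (d : nat) (u : 'rV[R]_d) (i : 'I_d) :
  dotv u (delta_mx 0 i) = u 0 i.
Proof.
rewrite /dotv (bigD1 i) //= big1 ?addr0 => [|j ji].
  by rewrite mxE !eqxx mulr1.
by rewrite mxE eqxx (negbTE ji) mulr0.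
Qed.

Lemma enorm_sqr (R : realType) (d : nat) (v : 'rV[R]_d) :
  enorm v ^+ 2 = dotv v v.
Proof.
rewrite sqr_sqrtr; first by apply: eq_bigr => i _; rewrite expr2.
by apply: sumr_ge0 => i _; exact: sqr_ge0.
Qed.

Lemma enorm_ge0 (R : realType) (d : nat) (v : 'rV[R]_d) : 0 <= enorm v.
Proof. exact: sqrtr_ge0. Qed.

Lemma enorm0 (R : realType) (d : nat) : enorm (0 : 'rV[R]_d) = 0.
Proof. by rewrite /enorm big1 ?sqrtr0 // => i _; rewrite mxE expr0n. Qed.

Lemma enormZ (R : realType) (d : nat) (a : R) (v : 'rV[R]_d) :
  enorm (a *: v) = `|a| * enorm v.
Proof.
apply/eqP; rewrite -(eqrXn2 (n := 2)) ?mulr_ge0 ?enorm_ge0 //.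
by rewrite exprMn real_normK ?num_real // !enorm_sqr dotvZr dotvC dotvZr mulrA.
Qed.

Lemma abs_coord_le_enorm (R : realType) (d : nat) (v : 'rV[R]_d) (i : 'I_d) :
  `|v 0 i| <= enorm v.
Proof.
rewrite -sqrtr_sqr ler_wsqrtr // (bigD1 i) //= lerDl.
by apply: sumr_ge0 => j _; exact: sqr_ge0.
Qed.

Lemma enorm_eq0 (R : realType) (d : nat) (v : 'rV[R]_d) : enorm v = 0 -> v = 0.
Proof.
move=> v0; apply/rowP => i; apply/eqP.
by rewrite mxE -normr_le0 -v0 abs_coord_le_enorm.
Qed.

(** * Operator norm *)

(** Needed for the [sup] in [opnorm] to dominate its set. In the unit ball every coordinate is at
    most 1 in absolute value, so row sums of [|A i j|] bound [v *m A] coordinatewise. *)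
Lemma has_ubound_opnorm (R : realType) (d : nat) (A : 'M[R]_d) :
  has_ubound [set enorm (v *m A) | v in [set v : 'rV[R]_d | enorm v <= 1]]%classic.
Proof.
exists (Num.sqrt (\sum_(j < d) (\sum_(i < d) `|A i j|) ^+ 2)) => _ [v /= v1 <-].
rewrite ler_wsqrtr //; apply: ler_sum => j _.
rewrite -real_normK ?num_real //= lerXn2r ?nnegrE ?sumr_ge0 //.
rewrite mxE (le_trans (ler_norm_sum _ _ _)) //; apply: ler_sum => i _.
by rewrite normrM ler_piMl // (le_trans (abs_coord_le_enorm _ _)).
Qed.

Lemma enorm_mulmx_le (R : realType) (d : nat) (A : 'M[R]_d) (v : 'rV[R]_d) :
  enorm (v *m A) <= opnorm A * enorm v.
Proof.
have [v0|v0] := eqVneq (enorm v) 0.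
  by rewrite (enorm_eq0 v0) mul0mx enorm0 mulr0.
have v_gt0 : 0 < enorm v by rewrite lt_neqAle eq_sym v0 enorm_ge0.
have := ub_le_sup (has_ubound_opnorm A) (ex_intro2 _ _ ((enorm v)^-1 *: v) _ erefl).
rewrite /= enormZ gtr0_norm ?invr_gt0 // mulVf // => /(_ (lexx _)).
rewrite -scalemxAl enormZ gtr0_norm ?invr_gt0 // mulrC ler_pdivrMr //.
Qed.

Lemma dotv_mulmx_le (R : realType) (d : nat) (A : 'M[R]_d) (L : R) (v : 'rV[R]_d) :
  0 < L -> opnorm A <= L -> dotv v (v *m A) <= L * dotv v v.
Proof.
move=> L0 AL.
have vA : enorm (v *m A) <= L * enorm v.
  by rewrite (le_trans (enorm_mulmx_le A v)) // ler_wpM2r ?enorm_ge0.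
(* AM-GM: 2 L <v, vA> <= |vA|^2 + L^2 |v|^2. *)
have : 0 <= dotv (v *m A + (- L) *: v) (v *m A + (- L) *: v).
  by rewrite -enorm_sqr sqr_ge0.
rewrite !(dotvDr, dotvZr) ![dotv (_ + _) _]dotvC !(dotvDr, dotvZr).
rewrite (dotvC (v *m A) v) -!enorm_sqr.
have : enorm (v *m A) ^+ 2 <= (L * enorm v) ^+ 2.
  by rewrite lerXn2r ?nnegrE ?mulr_ge0 ?enorm_ge0 // ltW.
rewrite exprMn => h1 h2.
rewrite -(ler_pM2l L0); lra.
Qed.

(** * Derivatives along lines and quadratic upper bounds *)

Lemma gradientP (R : realType) (d : nat) (g : 'rV[R]_d -> R) (x v : 'rV[R]_d) :
  differentiable g x -> 'D_v g x = dotv v (gradient g x).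
Proof.
move=> dg; rewrite deriveE // {1}(row_sum_delta v) linear_sum.
by apply: eq_bigr => i _; rewrite linearZ mxE deriveE.
Qed.

(** Both derivatives have the same difference quotient. The codomain [W] is general because the
    lemma serves a function and its gradient. *)
Lemma is_derive_line (R : realType) (d : nat) (W : normedModType R)
    (g : 'rV[R]_d -> W) (x v : 'rV[R]_d) (s : R) :
  differentiable g (x + s *: v) ->
  is_derive s 1 (fun r : R => g (x + r *: v)) ('D_v g (x + s *: v)).
Proof.
move=> dg.
have E : (fun h : R => h^-1 *: (((fun r : R => g (x + r *: v)) \o shift s) (h *: 1) - g (x + s *: v))) =
         (fun h : R => h^-1 *: ((g \o shift (x + s *: v)) (h *: v) - g (x + s *: v))).
  apply/funext => h /=; congr (_ *: (g _ - _)).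
  by rewrite /GRing.scale /= mulr1 -/(GRing.scale _ _) scalerDl addrCA.
split; first by rewrite /derivable E; exact: diff_derivable.
by rewrite /derive E.
Qed.

(** Two mean value steps, as continuity of [p''] is not at hand for an integral remainder: for some
    0 < e < c < 1, q(1) - q(0) = q'(c) = (p''(e) - M) c <= 0. *)
Lemma le_second_order (R : realType) (p p' p'' : R -> R) (M : R) :
  (forall s : R, is_derive s 1 p (p' s)) ->
  (forall s : R, is_derive s 1 p' (p'' s)) ->
  (forall s, p'' s <= M) -> p 1 <= p 0 + p' 0 + M / 2.
Proof.
move=> dp dp' p''M.
pose q s := p s - p' 0 * s - M / 2 * s ^+ 2.
have dq (s : R) : is_derive s 1 q (p' s - p' 0 - M * s).
  rewrite /q; apply: is_derive_eq.
  rewrite /GRing.scale /=; lra.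
have cont (u u' : R -> R) a b : (forall s : R, is_derive s 1 u (u' s)) ->
    ({within `[a, b], continuous u})%classic.
  by move=> du; apply: derivable_within_continuous => s _; exact: ex_derive.
have [c] := MVT (ltr01 : 0 < 1 :> R) (fun s _ => dq s) (cont _ _ _ _ dq).
rewrite in_itv /= => /andP[c0 c1].
have [e _] := MVT c0 (fun s _ => dp' s) (cont _ _ _ _ dp').
rewrite !subr0 => E1; rewrite E1 /q.
have : p'' e * c <= M * c by rewrite ler_wpM2r // ltW.
lra.
Qed.

Lemma descent_lemma (R : realType) (d : nat) (g : 'rV[R]_d -> R) (L : R) :
  0 < L -> twice_differentiable g -> (forall x, opnorm (hessian g x) <= L) ->
  forall x v, g (x + v) <= g x + dotv v (gradient g x) + L / 2 * dotv v v.
Proof.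
move=> L0 [dg d2g] gL x v.
pose p s := g (x + s *: v); pose p' s := dotv v (gradient g (x + s *: v)).
have dp (s : R) : is_derive s 1 p (p' s).
  by rewrite /p' -gradientP //; exact: is_derive_line.
have dp' (s : R) : is_derive s 1 p' (dotv v (v *m hessian g (x + s *: v))).
  have [D E] := is_derive_line (d2g (x + s *: v)).
  rewrite deriveEjacobian // derive_mx // in E.
  have /derivable_mxP Dij := D.
  rewrite /dotv -/(hessian g _) -E.
  (* As a finite sum of functions, [p'] is differentiated through the coordinates of the
     gradient. *)
  rewrite (_ : p' = \sum_(i < d) (fun r => v 0 i * gradient g (x + r *: v) 0 i)).
    apply: is_derive_sum => i.
    rewrite mxE; apply: is_deriveZ.
    exact: derivableP.
  by apply/funext => r; rewrite fct_sumE.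
have := le_second_order (M := L * dotv v v) dp dp'.
rewrite /p /p' scale1r scale0r addr0 => /(_ _)/le_trans -> //.
  by move=> s; exact: dotv_mulmx_le.
by rewrite mulrAC.
Qed.

(** Along each axis, [g] minus the paraboloid is maximal at the vertex, where the paraboloid has
    slope 0, so the partial derivative of [g] vanishes. *)
Lemma gradient_touch_eq0 (R : realType) (d : nat) (g : 'rV[R]_d -> R)
    (L : R) (x : 'rV[R]_d) :
  (forall y, differentiable g y) ->
  (forall v, g (x + v) <= g x + L / 2 * dotv v v) -> gradient g x = 0.
Proof.
move=> dg gx; apply/rowP => i; rewrite !mxE.
set e := delta_mx 0 i.
pose q s := g (x + s *: e) - L / 2 * s ^+ 2.
have dq (s : R) : is_derive s 1 q ('D_e g (x + s *: e) - L * s).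
  have := is_derive_line (v := e) (dg (x + s *: e)) => H.
  rewrite /q; apply: is_derive_eq.
  rewrite /GRing.scale /=; lra.
have [] : is_derive (0 : R) 1 q 0.
  apply: (@derive1_at_max R q (-1) 1 0) => [|s _||s _].
  - lra.
  - exact: ex_derive.
  - by rewrite in_itv /=; lra.
  - rewrite /q scale0r addr0 expr0n mulr0 subr0.
    have := gx (s *: e).
    rewrite dotvZr dotvC dotvZr dotv_delta mxE !eqxx mulr1; lra.
have [_ ->] := dq 0.
by rewrite scale0r addr0 mulr0 subr0.
Qed.

(** * One gradient step under a drifting objective *)

Section gradient_step.
(** [g0] and [g1] stand for f at consecutive sample times, [c] for the increment of [G] between them
    and [delta] for [G2 * h]. *)
Variables (R : realType) (d : nat) (g0 g1 : 'rV[R]_d -> R) (L c delta : R).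
Variables (x0 xs0 xs1 : 'rV[R]_d).
Hypotheses (L_gt0 : 0 < L) (g0_diff2 : twice_differentiable g0).
Hypothesis g0_hess : forall x, opnorm (hessian g0 x) <= L.
Hypothesis drift : forall y, `|g1 y - g0 y - c| <= delta.
Hypothesis xs0P : is_minimizer g0 xs0.

Let x1 := x0 - 1 / L *: gradient g0 x0.
Let gap_bound := g0 x0 - g0 xs0 + 2 * delta - 1 / (2 * L) * enorm (gradient g0 x0) ^+ 2.

Lemma gradient_step_paraboloid w :
  g1 (x1 + w) <=
  g0 x0 - 1 / (2 * L) * enorm (gradient g0 x0) ^+ 2 + c + delta + L / 2 * dotv w w.
Proof.
have := drift (x1 + w); rewrite ler_norml => /andP[_ dr].
have := descent_lemma L_gt0 g0_diff2 g0_hess x0 (w + (- (1 / L)) *: gradient g0 x0).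
rewrite (_ : x0 + _ = x1 + w); last by rewrite addrCA addrC scaleNr.
rewrite [dotv (_ + _) (gradient _ _)]dotvC !(dotvDr, dotvZr).
rewrite ![dotv (_ + _) _]dotvC !(dotvDr, dotvZr) enorm_sqr.
rewrite (dotvC (gradient _ _) w).
move: (dotv w w) (dotv w _) (dotv (gradient _ _) _) => p m n up.
(* With step size 1/L the terms linear in w cancel, which puts the vertex exactly at [x1]. *)
have E : m + - (1 / L) * n + L / 2 * (p + - (1 / L) * m + - (1 / L) * (m + - (1 / L) * n))
    = L / 2 * p - 1 / (2 * L) * n.
  by field; rewrite gt_eqF.
lra.
Qed.

(** The drift is paid twice, at [x1] and at [xs1], hence 2 delta; the shift [c] cancels. *)
Lemma gradient_step_gap : g1 x1 - g1 xs1 <= gap_bound.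
Proof.
have := gradient_step_paraboloid 0; rewrite addr0 -enorm_sqr enorm0 expr0n mulr0 addr0.
have := drift xs1; rewrite ler_norml => /andP[dr _].
have := xs0P xs1; rewrite /gap_bound; lra.
Qed.

(* Equality would make g1 touch its paraboloid upper bound at the vertex x1. *)
Lemma gradient_step_gap_lt :
  (forall y, differentiable g1 y) -> gradient g1 x1 != 0 ->
  g1 x1 - g1 xs1 < gap_bound.
Proof.
move=> dg1; apply: contraNT; rewrite -leNgt => ge_gap; apply/eqP.
apply: (gradient_touch_eq0 (L := L)) => // w.
have := gradient_step_paraboloid w.
have := drift xs1; rewrite ler_norml => /andP[dr _].
have := xs0P xs1; move: ge_gap; rewrite /gap_bound; lra.
Qed.

End gradient_step.

(** * The gap along the iterates *)

Theorem theorem2 (R : realType) (d : nat) (f : 'rV[R]_d -> R -> R)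
  (h L1 G2 : R) (xstar : R -> 'rV[R]_d) (x : nat -> 'rV[R]_d)
  (beta eps : R) (Tbar : nat)
  (h_gt0 : 0 < h) (L1_gt0 : 0 < L1) (G2_ge0 : 0 <= G2)
  (xstarP : forall t, 0 <= t -> is_minimizer (f ^~ t) (xstar t))
  (betaE : beta = 1 / L1)
  (x_tvgd : tvgd f h beta x)
  (f_diff2 : forall t, 0 <= t -> twice_differentiable (f ^~ t))
  (f_hess : forall (y : 'rV[R]_d) t, 0 <= t -> opnorm (hessian (f ^~ t) y) <= L1)
  (f_time : exists G : R -> R, forall (y : 'rV[R]_d) (s t : R),
    0 <= s -> 0 <= t ->
    `|(f y s - G s) - (f y t - G t)| <= G2 * `|s - t|)
  (epsE : eps = 2 * Num.sqrt (L1 * (1 + G2) * h))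
  (Tbar_stat : eps_stationary eps (f ^~ (sample_time h Tbar)) (x Tbar)) :
  forall k : nat, (Tbar <= k)%N ->
    eps_stationary eps (f ^~ (sample_time h k)) (x k) \/
    exists l : nat,
      [/\ (l < k)%N,
          eps_stationary eps (f ^~ (sample_time h l)) (x l) &
          opt_gap f xstar h x k <
            opt_gap f xstar h x l + 2 * G2 * h
            - 1 / (2 * L1) * enorm (gradient (f ^~ (sample_time h l)) (x l)) ^+ 2].
Proof.
case: f_time => G f_time.
have t_ge0 k : 0 <= sample_time h k by rewrite mulr_ge0 ?ler0n // ltW.
have drift k y : `|f y (sample_time h k.+1) - f y (sample_time h k)
    - (G (sample_time h k.+1) - G (sample_time h k))| <= G2 * h.
  have := f_time y _ _ (t_ge0 k.+1) (t_ge0 k).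
  rewrite /sample_time -mulrBl -natrB // subSnn mul1r (gtr0_norm h_gt0) => le_h.
  by rewrite (le_trans _ le_h) // le_eqVlt; apply/orP; left; apply/eqP; congr `|_|; lra.
have eps_ge0 : 0 <= eps by rewrite epsE mulr_ge0 ?sqrtr_ge0.
have eps2 : eps ^+ 2 = 4 * L1 * (1 + G2) * h.
  rewrite epsE exprMn sqr_sqrtr; first lra.
  by rewrite !mulr_ge0 ?addr_ge0 // ltW.
pose stat k := eps_stationary eps (f ^~ (sample_time h k)) (x k).
have gap_le k : opt_gap f xstar h x k.+1 <= opt_gap f xstar h x k + 2 * (G2 * h)
    - 1 / (2 * L1) * enorm (gradient (f ^~ (sample_time h k)) (x k)) ^+ 2.
  rewrite /opt_gap x_tvgd betaE.
  exact: (gradient_step_gap (g0 := f ^~ (sample_time h k)) (g1 := f ^~ (sample_time h k.+1))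
    (x k) _ L1_gt0 (f_diff2 _ (t_ge0 k)) (fun y => f_hess y _ (t_ge0 k)) (drift k) (xstarP _ (t_ge0 k))).
have gap_lt k : ~ stat k.+1 ->
    opt_gap f xstar h x k.+1 < opt_gap f xstar h x k + 2 * (G2 * h)
    - 1 / (2 * L1) * enorm (gradient (f ^~ (sample_time h k)) (x k)) ^+ 2.
  rewrite /stat /eps_stationary /opt_gap x_tvgd betaE => nstat.
  apply: (gradient_step_gap_lt (g0 := f ^~ (sample_time h k)) (g1 := f ^~ (sample_time h k.+1))
    _ L1_gt0 (f_diff2 _ (t_ge0 k)) (fun y => f_hess y _ (t_ge0 k)) (drift k) (xstarP _ (t_ge0 k))).
    exact: (f_diff2 _ (t_ge0 k.+1)).1.
  (* A zero gradient would make the next iterate stationary, as eps >= 0. *)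
  by apply/eqP => g0; apply: nstat; rewrite g0 enorm0.
(* The choice of eps gives eps^2 / (2 L1) = 2 (1 + G2) h, which exceeds the drift cost 2 G2 h by 2
   h. *)
have gap_decr k : ~ stat k -> opt_gap f xstar h x k.+1 < opt_gap f xstar h x k.
  move=> /negP; rewrite -ltNge => ngt.
  have : eps ^+ 2 < enorm (gradient (f ^~ (sample_time h k)) (x k)) ^+ 2.
    by rewrite ltrXn2r // ?nnegrE ?enorm_ge0.
  rewrite eps2 => lt2; apply: (le_lt_trans (gap_le k)).
  set n2 := _ ^+ 2 in lt2 *.
  have : 2 * ((1 + G2) * h) < 1 / (2 * L1) * n2.
    rewrite mul1r [ltRHS]mulrC ltr_pdivlMr ?mulr_gt0 //; lra.
  lra.
elim=> [|k IHk]; first by rewrite leqn0 => /eqP T0; left; move: Tbar_stat; rewrite T0.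
rewrite leq_eqVlt => /predU1P[TE|lekT]; first by left; move: Tbar_stat; rewrite TE.
have [|nstat1] := pselect (stat k.+1); [by left|right].
(* If x_k is stationary, l = k works by the strict one-step bound; otherwise the l found for k still
   works, since the gap has decreased. *)
have [st|nst] := pselect (stat k).
  by exists k; split=> //; rewrite -mulrA; exact: gap_lt.
have [//|[l [lk stl ltl]]] := IHk lekT.
by exists l; split=> //; [exact: ltnW|exact: lt_trans (gap_decr _ nst) ltl].
Qed.
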